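(* Let $\mathbb{F}$ be a division ring, $n$ a positive integer, $\sigma:\mathbb{F}\to\mathbb{F}^{n\times n}$ a ring morphism and $\delta:\mathbb{F}\to\mathbb{F}^n$ a $\sigma$-derivation. Let $\mathbf{a},\mathbf{b}_1,\mathbf{b}_2,\dots,\mathbf{b}_M\in\mathbb{F}^n$ and $\beta_1,\beta_2,\dots,\beta_M\in\mathbb{F}^*$ be such that $$\mathbf{b}_i=\mathbf{a}^{\beta_i}=\mathcal{D}_{\mathbf{a}}(\beta_i)\beta_i^{-1},$$ for $i=1,2,\dots,M$. Then $\mathcal{B}=\{\mathbf{b}_1,\mathbf{b}_2,\dots,\mathbf{b}_M\}$ is P-independent if, and only if, $\mathcal{B}^{\mathcal{D}}=\{\beta_1,\beta_2,\dots,\beta_M\}$ is right linearly independent over $K_{\mathbf{a}}$.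
   Context: Rings are associative with identity, not necessarily commutative, and ring morphisms preserve identities. $\mathbb{F}^*=\mathbb{F}\setminus\{0\}$ and $\mathbb{F}^n$ denotes column vectors. A map $\delta:\mathbb{F}\to\mathbb{F}^n$ is a $\sigma$-derivation if $\delta(a+b)=\delta(a)+\delta(b)$ and $\delta(ab)=\sigma(a)\delta(b)+\delta(a)b$ for all $a,b\in\mathbb{F}$. Free skew polynomial ring: let $\mathcal{M}$ be the free monoid on pairwise distinct variables $x_1,\dots,x_n$. $\mathbb{F}[\mathbf{x};\sigma,\delta]$ is the left $\mathbb{F}$-vector space with basis $\mathcal{M}$, with the ring product given by concatenating monomials and $x_i a=\sum_{j=1}^n\sigma_{i,j}(a)x_j+\delta_i(a)$ for $a\in\mathbb{F}$, where $\sigma_{i,j}$ and $\delta_i$ are the components of $\sigma$ and $\delta$. Its elements are called skew polynomials. Skew evaluation: for $\mathbf{a}=(a_1,\dots,a_n)\in\mathbb{F}^n$ and a skew polynomial $F$, $F(\mathbf{a})$ is the unique element of $\mathbb{F}$ such that $F-F(\mathbf{a})$ belongs to the left ideal generated by $x_1-a_1,\dots,x_n-a_n$. Conjugates and centralizers: $\mathcal{D}_{\mathbf{a}}(\beta)=\sigma(\beta)\mathbf{a}+\delta(\beta)\in\mathbb{F}^n$ for $\beta\in\mathbb{F}$; $\mathbf{a}^\beta=\mathcal{D}_{\mathbf{a}}(\beta)\beta^{-1}$ for $\beta\in\mathbb{F}^*$; $K_{\mathbf{a}}=\{\beta\in\mathbb{F}\mid\mathcal{D}_{\mathbf{a}}(\beta)=\mathbf{a}\beta\}$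 is the centralizer of $\mathbf{a}$, a division subring of $\mathbb{F}$. P-independence: for $\Omega\subseteq\mathbb{F}^n$, $I(\Omega)=\{F\in\mathbb{F}[\mathbf{x};\sigma,\delta]\mid F(\mathbf{a})=0\ \forall\mathbf{a}\in\Omega\}$; for a set $\mathcal{A}$ of skew polynomials, $Z(\mathcal{A})=\{\mathbf{a}\in\mathbb{F}^n\mid F(\mathbf{a})=0\ \forall F\in\mathcal{A}\}$; the P-closure is $\overline{\Omega}=Z(I(\Omega))$. A set $\Omega\subseteq\mathbb{F}^n$ is P-independent if $\mathbf{a}\notin\overline{\Omega\setminus\{\mathbf{a}\}}$ for all $\mathbf{a}\in\Omega$.
   Formalization: The lists are read as indexed families: P-independence of B also requires b_1,…,b_M to be pairwise distinct, since otherwise two β's differing by a factor in K_a give a one-element (P-independent) B while the β's are right dependent. *)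

(* Defs.v *)
From HB Require Import structures.
From mathcomp Require Import all_boot all_order all_algebra.
From mathcomp Require Import finmap.
From mathcomp Require Import boolp classical_sets.
From mathcomp Require Import monalg.

Set Implicit Arguments.
Unset Strict Implicit.
Unset Printing Implicit Defensive.

Import GRing.Theory.

Local Open Scope classical_set_scope.
Local Open Scope ring_scope.

Definition division_ring (F : unitRingType) : Prop :=
  forall x : F, x != 0 -> x \is a GRing.unit.

Definition rscalev (F : pzRingType) (n : nat) (v : 'cV[F]_n) (c : F) : 'cV[F]_n :=
  \col_i (v i 0 * c).

Definition sderivation_axiom (F : nzRingType) (n : nat)
    (sigma : {rmorphism F -> 'M[F]_n}) (delta : F -> 'cV[F]_n) : Prop :=
  (forall a b, delta (a + b) = delta a + delta b) /\
  (forall a b, delta (a * b) = sigma a *m delta b + rscalev (delta a) b).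

Record sderivation (F : nzRingType) (n : nat)
    (sigma : {rmorphism F -> 'M[F]_n}) := SDerivation {
  sder :> F -> 'cV[F]_n;
  sderP : sderivation_axiom sigma sder
}.

(* The left F-module with basis the free monoid on n letters; a word
   [:: i; j; k] stands for the monomial x_i x_j x_k. The twist enters only
   through the product below, so [delta] is a phantom argument here. *)
Definition skewpoly (F : nzRingType) (n : nat)
    (sigma : {rmorphism F -> 'M[F]_n}) (delta : sderivation sigma) : Type :=
  {malg F[seq 'I_n]}.

Section SkewPoly.
Context (F : nzRingType) (n : nat) (sigma : {rmorphism F -> 'M[F]_n}).
Context (delta : sderivation sigma).

Local Notation S := (skewpoly delta).

HB.instance Definition _ := GRing.Lmodule.copy S {malg F[seq 'I_n]}.

Definition skmon (c : F) (m : seq 'I_n) : S := << c *g m >>.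
Definition skewC (c : F) : S := skmon c [::].
Definition skewX (i : 'I_n) : S := skmon 1 [:: i].

(* Left multiplication by x_i, using
   x_i c m = (\sum_j sigma_ij(c) x_j + delta_i(c)) m for a monomial m. *)
Definition mulX (i : 'I_n) (G : S) : S :=
  \sum_(m <- msupp G)
    (\sum_j skmon (sigma G@_m i j) (j :: m) + skmon (delta G@_m i 0) m).

Definition mulmon (u : seq 'I_n) (G : S) : S := foldr mulX G u.

Definition skewmul (G H : S) : S := \sum_(u <- msupp G) G@_u *: mulmon u H.

Lemma sderD a b : delta (a + b) = delta a + delta b.
Proof. exact: (sderP delta).1. Qed.

Lemma sderM a b : delta (a * b) = sigma a *m delta b + rscalev (delta a) b.
Proof. exact: (sderP delta).2. Qed.

Lemma sder0 : delta 0 = 0.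
Proof. by apply: (addIr (delta 0)); rewrite -sderD !add0r. Qed.

Lemma sder1 : delta 1 = 0.
Proof.
apply: (addIr (delta 1)); rewrite add0r -{3}[1 : F]mulr1 sderM rmorph1 mul1mx.
by congr (_ + _); apply/matrixP => i j; rewrite mxE mulr1 ord1.
Qed.

Fact skmonD m c d : skmon (c + d) m = skmon c m + skmon d m.
Proof. exact: monalgUD. Qed.

Fact skmon0 m : skmon 0 m = 0.
Proof. exact: monalgU0. Qed.

Fact skmon_sum m (I : Type) (r : seq I) (E : I -> F) :
  skmon (\sum_(k <- r) E k) m = \sum_(k <- r) skmon (E k) m.
Proof. exact: (big_morph _ (fun c d => skmonD m c d) (skmon0 m)). Qed.

Fact skmonZ c d m : c *: skmon d m = skmon (c * d) m.
Proof.
by apply/malgP => k; rewrite mcoeffZ /skmon !mcoeffU mulrnAr.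
Qed.

Definition lin1 (f : F -> seq 'I_n -> S) (G : S) := \sum_(m <- msupp G) f G@_m m.

Fact lin1w f (d : {fset seq 'I_n}) (G : S) :
  (forall m, f 0 m = 0) -> (msupp G `<=` d)%fset ->
  lin1 f G = \sum_(m <- d) f G@_m m.
Proof.
move=> f0 le; rewrite /lin1 (big_fset_incl _ le) //= => m _ /mcoeff_outdom ->.
exact: f0.
Qed.

Fact lin1D f : (forall m, f 0 m = 0) ->
  (forall c d m, f (c + d) m = f c m + f d m) ->
  forall G H : S, lin1 f (G + H) = lin1 f G + lin1 f H.
Proof.
move=> f0 fD G H; set d := (msupp G `|` msupp H)%fset.
rewrite !(@lin1w f d) ?fsubsetUl ?fsubsetUr //; last exact: msuppD_le.
by rewrite -big_split; apply: eq_bigr => m _; rewrite mcoeffD fD.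
Qed.

Fact lin1U f c m : (forall m, f 0 m = 0) -> lin1 f (skmon c m) = f c m.
Proof.
move=> f0; rewrite (@lin1w f [fset m]%fset) ?msuppU_le //.
by rewrite big_seq_fset1 mcoeffUU.
Qed.

Fact mulX_f0 i m :
  \sum_j skmon (sigma 0 i j) (j :: m) + skmon (delta 0 i 0) m = 0.
Proof.
rewrite rmorph0 sder0 big1 ?add0r => [|j _]; rewrite mxE skmon0 //.
Qed.

Fact mulXD i G H : mulX i (G + H) = mulX i G + mulX i H.
Proof.
apply: (@lin1D (fun c m =>
  \sum_j skmon (sigma c i j) (j :: m) + skmon (delta c i 0) m)).
  exact: mulX_f0.
move=> c d m; rewrite rmorphD sderD mxE skmonD addrACA -big_split.
by congr (_ + _); apply: eq_bigr => j _; rewrite mxE skmonD.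
Qed.

Fact mulXU i c m : mulX i (skmon c m) =
  \sum_j skmon (sigma c i j) (j :: m) + skmon (delta c i 0) m.
Proof.
apply: (@lin1U (fun c m =>
  \sum_j skmon (sigma c i j) (j :: m) + skmon (delta c i 0) m)).
exact: mulX_f0.
Qed.

Fact mulX0 i : mulX i 0 = 0.
Proof. by rewrite -(skmon0 [::]) mulXU mulX_f0 skmon0. Qed.

Fact skew_ind (P : S -> Prop) :
  P 0 -> (forall c m G, P G -> P (skmon c m + G)) -> forall G, P G.
Proof.
move=> P0 PD G; rewrite [G]monalgE.
by elim/big_rec: _ => [|m H _ IH]; [exact: P0 | exact: PD].
Qed.

Fact scale_sumD (c : 'I_n -> F) d (A B : 'I_n -> S) (G H : S) :
  (\sum_j c j *: A j + d *: G) + (\sum_j c j *: B j + d *: H) =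
  \sum_j c j *: (A j + B j) + d *: (G + H).
Proof.
rewrite addrACA -scalerDr -big_split; congr (_ + _).
by apply: eq_bigr => j _; rewrite scalerDr.
Qed.

Fact mulXZ i c G :
  mulX i (c *: G) = \sum_j sigma c i j *: mulX j G + delta c i 0 *: G.
Proof.
elim/skew_ind: G => [|d m G IH].
  by rewrite !scaler0 mulX0 big1 ?addr0 // => j _; rewrite mulX0 scaler0.
rewrite scalerDr mulXD IH.
transitivity (
    (\sum_j sigma c i j *: mulX j (skmon d m) + delta c i 0 *: skmon d m) +
    (\sum_j sigma c i j *: mulX j G + delta c i 0 *: G)); last first.
  rewrite scale_sumD; apply: (congr1 (+%R^~ _)).
  by apply: eq_bigr => j _; rewrite (mulXD j).
congr (_ + _); rewrite skmonZ mulXU.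
rewrite rmorphM sderM !mxE skmonD addrA skmonZ; congr (_ + _).
under [RHS]eq_bigr do rewrite mulXU scalerDr skmonZ scaler_sumr.
rewrite big_split /= exchange_big /=; congr (_ + _).
  apply: eq_bigr => j _; rewrite mxE skmon_sum; apply: eq_bigr => k _.
  by rewrite skmonZ.
exact: skmon_sum.
Qed.

Fact mulX_sum i (I : Type) (r : seq I) (E : I -> S) :
  mulX i (\sum_(k <- r) E k) = \sum_(k <- r) mulX i (E k).
Proof. exact: (big_morph _ (mulXD i) (mulX0 i)). Qed.

Fact skewmul0 H : skewmul 0 H = 0.
Proof. by rewrite /skewmul msupp0 big_seq_fset0. Qed.

Fact skewmulDl G1 G2 H : skewmul (G1 + G2) H = skewmul G1 H + skewmul G2 H.
Proof.
apply: (@lin1D (fun c u => c *: mulmon u H)) => [u|c d u].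
  by rewrite scale0r.
by rewrite scalerDl.
Qed.

Fact skewmulU c u H : skewmul (skmon c u) H = c *: mulmon u H.
Proof. by apply: (@lin1U (fun c u => c *: mulmon u H)) => v; rewrite scale0r. Qed.

Fact skewmul_sum (I : Type) (r : seq I) (E : I -> S) H :
  skewmul (\sum_(k <- r) E k) H = \sum_(k <- r) skewmul (E k) H.
Proof. exact: (big_morph (skewmul^~ H) (fun _ _ => skewmulDl _ _ H) (skewmul0 H)). Qed.

Fact skewmulZl c G H : skewmul (c *: G) H = c *: skewmul G H.
Proof.
elim/skew_ind: G => [|d m G IH]; first by rewrite !(scaler0, skewmul0).
by rewrite scalerDr !skewmulDl IH scalerDr skmonZ !skewmulU scalerA.
Qed.

Fact mulmonD u G H : mulmon u (G + H) = mulmon u G + mulmon u H.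
Proof. by elim: u => //= i u ->; rewrite mulXD. Qed.

Fact skewmulDr G H1 H2 : skewmul G (H1 + H2) = skewmul G H1 + skewmul G H2.
Proof.
by rewrite -big_split; apply: eq_bigr => u _; rewrite mulmonD scalerDr.
Qed.

Fact skewmul_mulX i G H : skewmul (mulX i G) H = mulX i (skewmul G H).
Proof.
elim/skew_ind: G => [|c m G IH]; first by rewrite mulX0 skewmul0 mulX0.
rewrite mulXD !skewmulDl mulXD IH; congr (_ + _).
rewrite mulXU skewmulU mulXZ skewmulDl skewmul_sum skewmulU; congr (_ + _).
by apply: eq_bigr => j _; rewrite skewmulU.
Qed.

Fact skewmul_mulmon u G H : skewmul (mulmon u G) H = mulmon u (skewmul G H).
Proof. by elim: u => //= i u IH; rewrite skewmul_mulX IH. Qed.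

Fact skewmulA : associative skewmul.
Proof.
move=> G H K; rewrite [in RHS]/skewmul -/(skewmul _ _) skewmul_sum.
by apply: eq_bigr => u _; rewrite skewmulZl skewmul_mulmon.
Qed.

Fact mulmon_skmon u m : mulmon u (skmon 1 m) = skmon 1 (u ++ m).
Proof.
elim: u => //= i u ->; rewrite mulXU rmorph1 sder1 mxE skmon0 addr0.
rewrite (bigD1 i) //= mxE eqxx big1 ?addr0 // => j ji.
by rewrite mxE eq_sym (negbTE ji) skmon0.
Qed.

Fact skewmul1l : left_id (skmon 1 [::]) skewmul.
Proof. by move=> G; rewrite skewmulU scale1r. Qed.

Fact skewmul1r : right_id (skmon 1 [::]) skewmul.
Proof.
move=> G; rewrite {2}[G]monalgE; apply: eq_bigr => u _.
by rewrite mulmon_skmon cats0 skmonZ mulr1.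
Qed.

Fact skew_oner_neq0 : skmon 1 [::] != 0 :> S.
Proof. by rewrite monalgU_eq0 oner_eq0. Qed.

HB.instance Definition _ := GRing.Zmodule_isNzRing.Build S
  skewmulA skewmul1l skewmul1r skewmulDl skewmulDr skew_oner_neq0.

(* The defining relations of the free skew polynomial ring. *)
Lemma skewX_C i c :
  skewX i * skewC c = \sum_j skewC (sigma c i j) * skewX j + skewC (delta c i 0).
Proof.
rewrite [LHS]skewmulU scale1r /= mulXU; congr (_ + _); apply: eq_bigr => j _.
by rewrite [RHS]skewmulU skmonZ mulr1.
Qed.

Lemma skmonM u v : skmon 1 u * skmon 1 v = skmon 1 (u ++ v).
Proof. by rewrite [LHS]skewmulU scale1r mulmon_skmon. Qed.

Lemma skewC_mul c G : skewC c * G = c *: G.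
Proof. exact: skewmulU. Qed.

Definition left_ideal (I : finType) (g : I -> S) : set S :=
  [set G | exists h : I -> S, G = \sum_i h i * g i].

Definition eval_ideal (a : 'cV[F]_n) : set S :=
  left_ideal (fun i => skewX i - skewC (a i 0)).

(* The default 0 of [xget] is never reached and the remainder does not depend
   on a choice: see [skew_evalP]. *)
Definition skew_eval (G : S) (a : 'cV[F]_n) : F :=
  xget 0 [set c | eval_ideal a (G - skewC c)].

Definition evX (a : 'cV[F]_n) i (c : F) : F :=
  \sum_j sigma c i j * a j 0 + delta c i 0.

Definition evm a (m : seq 'I_n) : F := foldr (evX a) 1 m.

Definition ev a (G : S) : F := \sum_(m <- msupp G) G@_m * evm a m.

Fact evXD a i c d : evX a i (c + d) = evX a i c + evX a i d.
Proof.
rewrite /evX rmorphD sderD mxE addrACA -big_split; congr (_ + _).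
by apply: eq_bigr => j _; rewrite mxE mulrDl.
Qed.

Fact evX0 a i : evX a i 0 = 0.
Proof.
rewrite /evX rmorph0 sder0 mxE addr0 big1 // => j _.
by rewrite mxE mul0r.
Qed.

Fact evXM a i c d :
  evX a i (c * d) = \sum_j sigma c i j * evX a j d + delta c i 0 * d.
Proof.
rewrite /evX rmorphM sderM !mxE addrA; congr (_ + _).
under [RHS]eq_bigr do rewrite mulrDr mulr_sumr.
rewrite big_split /= exchange_big /=; congr (_ + _).
apply: eq_bigr => j _; rewrite mxE mulr_suml; apply: eq_bigr => k _.
by rewrite mulrA.
Qed.

Fact ev_w a (d : {fset seq 'I_n}) (G : S) : (msupp G `<=` d)%fset ->
  ev a G = \sum_(m <- d) G@_m * evm a m.
Proof.
move=> le; rewrite /ev (big_fset_incl _ le) //= => m _ /mcoeff_outdom ->.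
by rewrite mul0r.
Qed.

Fact evD a G H : ev a (G + H) = ev a G + ev a H.
Proof.
set d := (msupp G `|` msupp H)%fset.
rewrite !(@ev_w _ d) ?fsubsetUl ?fsubsetUr //; last exact: msuppD_le.
by rewrite -big_split; apply: eq_bigr => m _; rewrite mcoeffD mulrDl.
Qed.

Fact evU a c m : ev a (skmon c m) = c * evm a m.
Proof. by rewrite (@ev_w _ [fset m]%fset) ?msuppU_le // big_seq_fset1 mcoeffUU. Qed.

Fact ev0 a : ev a 0 = 0.
Proof. by rewrite -(skmon0 [::]) evU mul0r. Qed.

Fact evZ a c G : ev a (c *: G) = c * ev a G.
Proof.
elim/skew_ind: G => [|d m G IH]; first by rewrite scaler0 ev0 mulr0.
by rewrite scalerDr !evD IH mulrDr skmonZ !evU mulrA.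
Qed.

Fact evB a G H : ev a (G - H) = ev a G - ev a H.
Proof. by rewrite evD -scaleN1r evZ mulN1r. Qed.

Fact ev_sum a (I : Type) (r : seq I) (E : I -> S) :
  ev a (\sum_(k <- r) E k) = \sum_(k <- r) ev a (E k).
Proof. exact: (big_morph _ (evD a) (ev0 a)). Qed.

Fact ev_mulX a i G : ev a (mulX i G) = evX a i (ev a G).
Proof.
elim/skew_ind: G => [|c m G IH]; first by rewrite mulX0 ev0 evX0.
rewrite mulXD !evD evXD IH; congr (_ + _).
rewrite mulXU evD ev_sum !evU evXM; congr (_ + _).
by apply: eq_bigr => j _; rewrite evU.
Qed.

Fact ev_mul0 a G H : ev a H = 0 -> ev a (G * H) = 0.
Proof.
move=> H0; rewrite [G * H]/(skewmul G H) /skewmul ev_sum big1 // => u _.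
rewrite evZ (_ : ev a _ = 0) ?mulr0 //.
by elim: u => //= i u IH; rewrite ev_mulX IH evX0.
Qed.

Fact ev_ideal a G : eval_ideal a G -> ev a G = 0.
Proof.
move=> [h ->]; rewrite ev_sum big1 // => i _; apply: ev_mul0.
rewrite (evB a (skewX i)) /skewX /skewC !(evU a).
rewrite mul1r mulr1 /= /evX.
rewrite rmorph1 sder1 mxE addr0 (bigD1 i) //= mxE eqxx mul1r big1 ?addr0 ?subrr //.
by move=> j ji; rewrite mxE eq_sym (negbTE ji) mul0r.
Qed.

Fact eval_ideal0 a : eval_ideal a 0.
Proof. by exists (fun=> 0); rewrite big1 // => i _; rewrite mul0r. Qed.

Fact eval_idealD a G H :
  eval_ideal a G -> eval_ideal a H -> eval_ideal a (G + H).
Proof.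
move=> [g ->] [h ->]; exists (fun i => g i + h i).
by rewrite -big_split; apply: eq_bigr => i _; rewrite mulrDl.
Qed.

Fact eval_idealM a G H : eval_ideal a H -> eval_ideal a (G * H).
Proof.
move=> [h ->]; exists (fun i => G * h i).
by rewrite mulr_sumr; apply: eq_bigr => i _; rewrite mulrA.
Qed.

Fact eval_idealX a i : eval_ideal a (skewX i - skewC (a i 0)).
Proof.
exists (fun j => (j == i)%:R); rewrite (bigD1 i) //= eqxx mul1r big1 ?addr0 //.
by move=> j /negbTE ->; rewrite mul0r.
Qed.

Fact skewCD c d : skewC (c + d) = skewC c + skewC d.
Proof. exact: skmonD. Qed.

Fact skewCM c d : skewC (c * d) = skewC c * skewC d.
Proof. by rewrite skewC_mul skmonZ. Qed.

Fact skewC_sum (I : Type) (r : seq I) (E : I -> F) :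
  skewC (\sum_(k <- r) E k) = \sum_(k <- r) skewC (E k).
Proof. exact: skmon_sum. Qed.

Fact eval_ideal_ev a G : eval_ideal a (G - skewC (ev a G)).
Proof.
elim/skew_ind: G => [|c m G IH].
  by rewrite ev0 [skewC 0]skmon0 subr0; exact: eval_ideal0.
rewrite (evD a) skewCD opprD addrACA.
apply: eval_idealD; last exact: IH.
rewrite evU.
have -> : skmon c m = skewC c * skmon 1 m by rewrite skewC_mul skmonZ mulr1.
rewrite skewCM -mulrBr; apply: eval_idealM.
elim: m => [|i m IHm] /=; first by rewrite subrr; exact: eval_ideal0.
have -> : skmon 1 (i :: m) = skewX i * skmon 1 m by rewrite skmonM.
rewrite -[_ * _](subrK (skewX i * skewC (evm a m))) -mulrBr -addrA.
apply: eval_idealD; first exact: eval_idealM.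
rewrite skewX_C skewCD skewC_sum opprD addrACA subrr addr0 -sumrB.
apply: (big_ind (eval_ideal a)) => [||j _]; first exact: eval_ideal0.
  exact: eval_idealD.
by rewrite skewCM -mulrBr; apply/eval_idealM/eval_idealX.
Qed.

Lemma skew_evalP (G : S) (a : 'cV[F]_n) (c : F) :
  eval_ideal a (G - skewC c) <-> c = skew_eval G a.
Proof.
have uniq d : eval_ideal a (G - skewC d) -> d = ev a G.
  move=> /ev_ideal /eqP; rewrite (evB a G) (evU a _ [::]) mulr1.
  by rewrite subr_eq0 => /eqP.
have E : skew_eval G a = ev a G.
  apply: uniq; rewrite /skew_eval.
  by case: xgetP => [d _ //|/(_ (ev a G)) []]; exact: eval_ideal_ev.
by split=> [/uniq ->|->]; rewrite E //; exact: eval_ideal_ev.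
Qed.

End SkewPoly.

Arguments skew_eval {F n sigma delta} G a.

Section Conjugacy.
Context (F : unitRingType) (n : nat) (sigma : {rmorphism F -> 'M[F]_n}).
Context (delta : sderivation sigma).

Definition Dmap (a : 'cV[F]_n) (c : F) : 'cV[F]_n := sigma c *m a + delta c.

Definition conjugate (a : 'cV[F]_n) (c : F) : 'cV[F]_n :=
  rscalev (Dmap a c) c^-1.

Definition centralizer (a : 'cV[F]_n) : set F :=
  [set c | Dmap a c = rscalev a c].

Definition vanishing (Omega : set 'cV[F]_n) : set (skewpoly delta) :=
  [set G | forall a, Omega a -> skew_eval G a = 0].

Definition zeros (A : set (skewpoly delta)) : set 'cV[F]_n :=
  [set a | forall G, A G -> skew_eval G a = 0].

Definition Pclosure (Omega : set 'cV[F]_n) : set 'cV[F]_n :=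
  zeros (vanishing Omega).

Definition Pindependent (Omega : set 'cV[F]_n) : Prop :=
  forall a, Omega a -> ~ Pclosure (Omega `\ a) a.

End Conjugacy.

Definition right_independent (F : pzRingType) (K : set F) (I : finType)
    (beta : I -> F) : Prop :=
  forall c : I -> F, (forall i, K (c i)) ->
    \sum_i beta i * c i = 0 -> forall i, c i = 0.

(* Main.v *)
Require Import Defs.
From mathcomp Require Import all_boot all_order all_algebra.
From mathcomp Require Import finmap.
From mathcomp Require Import boolp classical_sets.
From mathcomp Require Import monalg.

Set Implicit Arguments.
Unset Strict Implicit.
Unset Printing Implicit Defensive.

(** The skew polynomial ring acts on F, with x_i acting as the i-th component
    of D_a and constants acting by left multiplication.  The value of G at
    a^beta is (G . beta) beta^-1, so both conditions of the theorem say that no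
    beta_k is annihilated by all the skew polynomials annihilating the other
    beta_i.  The right multiplications commuting with the action are those by
    elements of K_a, and one direction is their linearity; the other one is the
    argument of Jacobson's density theorem. *)

Import GRing.Theory.

Local Open Scope classical_set_scope.
Local Open Scope ring_scope.

Section Action.
Context (F : nzRingType) (n : nat) (sigma : {rmorphism F -> 'M[F]_n}).
Context (delta : sderivation sigma) (a : 'cV[F]_n).

Local Notation S := (skewpoly delta).
Local Notation D := (evX delta a).

(** Folding from x where [evm] folds from 1 turns evaluation at a into an action on F; [ev a G] is
    [act G 1]. *)
Definition act (G : S) (x : F) : F := \sum_(m <- msupp G) G@_m * foldr D x m.

Lemma act_wide (d : {fset seq 'I_n}) (G : S) x : (msupp G `<=` d)%fset ->
  act G x = \sum_(m <- d) G@_m * foldr D x m.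
Proof.
move=> le; rewrite /act (big_fset_incl _ le) //= => m _ /mcoeff_outdom ->.
by rewrite mul0r.
Qed.

Lemma actDl (G H : S) x : act (G + H) x = act G x + act H x.
Proof.
set d := (msupp G `|` msupp H)%fset.
rewrite !(@act_wide d) ?fsubsetUl ?fsubsetUr //; last exact: msuppD_le.
by rewrite -big_split; apply: eq_bigr => m _; rewrite mcoeffD mulrDl.
Qed.

Lemma act_skmon c m x : act (skmon delta c m) x = c * foldr D x m.
Proof.
by rewrite (@act_wide [fset m]%fset) ?msuppU_le // big_seq_fset1 mcoeffUU.
Qed.

Lemma act0l x : act 0 x = 0.
Proof. by rewrite -(skmon0 delta [::]) act_skmon mul0r. Qed.

Lemma act_suml x (I : Type) (r : seq I) (E : I -> S) :
  act (\sum_(k <- r) E k) x = \sum_(k <- r) act (E k) x.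
Proof. exact: (big_morph (act^~ x) (fun _ _ => actDl _ _ x) (act0l x)). Qed.

Lemma actZl c (G : S) x : act (c *: G) x = c * act G x.
Proof.
elim/(@skew_ind _ _ _ delta): G => [|d m G IH].
  by rewrite scaler0 act0l mulr0.
by rewrite scalerDr !actDl IH mulrDr skmonZ !act_skmon mulrA.
Qed.

(** The product rule [evXM] of D mirrors the commutation rule moving x_i past a constant. *)
Lemma act_mulX i (G : S) x : act (mulX i G) x = D i (act G x).
Proof.
elim/(@skew_ind _ _ _ delta): G => [|c m G IH].
  by rewrite mulX0 act0l evX0.
rewrite mulXD !actDl evXD IH; congr (_ + _).
rewrite mulXU actDl act_suml !act_skmon evXM; congr (_ + _).
by apply: eq_bigr => j _; rewrite act_skmon.
Qed.

Lemma actDr (G : S) x y : act G (x + y) = act G x + act G y.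
Proof.
rewrite /act -big_split; apply: eq_bigr => m _ /=; rewrite -mulrDr.
by congr (_ * _); elim: m => //= i m ->; rewrite evXD.
Qed.

Lemma act0r (G : S) : act G 0 = 0.
Proof. by apply: (addIr (act G 0)); rewrite -actDr !add0r. Qed.

Lemma act_sumr (G : S) (I : Type) (r : seq I) (P : pred I) (E : I -> F) :
  act G (\sum_(k <- r | P k) E k) = \sum_(k <- r | P k) act G (E k).
Proof. exact: (big_morph _ (actDr G) (act0r G)). Qed.

Lemma evX1 i : D i 1 = a i 0.
Proof.
rewrite /evX rmorph1 sder1 mxE addr0 (bigD1 i) //= mxE eqxx mul1r.
by rewrite big1 ?addr0 // => j ji; rewrite mxE eq_sym (negbTE ji) mul0r.
Qed.

End Action.

Section Centralizer.
Context (F : unitRingType) (n : nat) (sigma : {rmorphism F -> 'M[F]_n}).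
Context (delta : sderivation sigma) (a : 'cV[F]_n).

Local Notation S := (skewpoly delta).
Local Notation D := (evX delta a).
Local Notation K := (centralizer delta a).
Local Notation act := (act a).

Lemma DmapE c i : Dmap delta a c i 0 = D i c.
Proof. by rewrite !mxE. Qed.

Lemma centralizerE c : K c <-> forall i, D i c = a i 0 * c.
Proof.
split=> [Kc i|Kc]; first by rewrite -DmapE Kc mxE.
by apply/matrixP => i j; rewrite ord1 DmapE mxE Kc.
Qed.

(** The product rule expands D_i(x c) through the D_j(c), and each of these is a_j c, so c factors
    out on the right. *)
Lemma evX_centralizer x c i : K c -> D i (x * c) = D i x * c.
Proof.
move=> /centralizerE Kc; rewrite evXM [in RHS]/evX mulrDl mulr_suml.
by congr (_ + _); apply: eq_bigr => j _; rewrite Kc mulrA.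
Qed.

Lemma act_centralizer (G : S) x c : K c -> act G (x * c) = act G x * c.
Proof.
move=> Kc; rewrite mulr_suml; apply: eq_bigr => m _; rewrite -mulrA.
by congr (_ * _); elim: m => //= i m ->; rewrite evX_centralizer.
Qed.

Lemma centralizer0 : K 0.
Proof. by apply/centralizerE => i; rewrite evX0 mulr0. Qed.

Lemma centralizer1 : K 1.
Proof. by apply/centralizerE => i; rewrite evX1 mulr1. Qed.

Lemma centralizerN c : K c -> K (- c).
Proof.
move=> /centralizerE Kc; apply/centralizerE => i; apply: (addIr (D i c)).
by rewrite -evXD addNr evX0 Kc -mulrDr addNr mulr0.
Qed.

(** With b the conjugate of a by x, D_j(x) = b_j x; the product rule then carries right
    multiplication by x from the action at b to the one at a, letter by letter. *)
Lemma act_conjugate (G : S) x : x \is a GRing.unit ->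
  act G x = skew_eval G (conjugate delta a x) * x.
Proof.
move=> Ux; set b := conjugate delta a x.
have <- : ev b G = skew_eval G b by apply/skew_evalP/eval_ideal_ev.
rewrite mulr_suml; apply: eq_bigr => m _; rewrite -mulrA; congr (_ * _).
elim: m => [|i m IH] /=; first by rewrite mul1r.
rewrite IH evXM [evX _ b i _]/evX mulrDl mulr_suml; congr (_ + _).
by apply: eq_bigr => j _; rewrite -mulrA [b j 0]mxE DmapE mulrVK.
Qed.

Hypothesis hF : division_ring F.

(* Density argument: let every G killing x i0 and the x i, i \in s, kill y,
   and let G0 kill the latter and send x i0 to 1.  Comparing G with
   act G (x i0) *: G0 gives act G y = act G (x i0) * c, where c = act G0 y, for
   all G killing the x i, i \in s; taking G = mulX j G0 for each j shows that c
   centralizes a. *)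
Lemma annihilator_span (I : eqType) (s : seq I) (x : I -> F) (y : F) :
  uniq s ->
  (forall G : S, (forall i, i \in s -> act G (x i) = 0) -> act G y = 0) ->
  exists2 c : I -> F, (forall i, K (c i)) & y = \sum_(i <- s) x i * c i.
Proof.
elim: s y => [|i0 s IH] y /=.
  move=> _ /(_ (skmon delta 1 [::])); rewrite act_skmon mul1r /= => -> //.
  by exists (fun=> 0) => [i|]; [exact: centralizer0 | rewrite big_nil].
move=> /andP[i0s us] killy.
(* Both cases below end by applying the induction hypothesis to y - x i0 * c0. *)
have span c0 : K c0 ->
    (forall G : S, (forall i, i \in s -> act G (x i) = 0) ->
       act G y = act G (x i0) * c0) ->
    exists2 c : I -> F, (forall i, K (c i)) &
      y = \sum_(i <- i0 :: s) x i * c i.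
  move=> Kc0 Gy; have [|c Kc yE] := IH (y - x i0 * c0) us.
    move=> G Gs; rewrite -mulrN actDr act_centralizer ?Gy //.
      by rewrite -mulrDr addrN mulr0.
    exact: centralizerN.
  exists (fun i => if i == i0 then c0 else c i) => [i|]; first by case: eqP.
  rewrite big_cons eqxx; apply/eqP; rewrite addrC -subr_eq yE; apply/eqP.
  apply: eq_big_seq => i si; case: eqP => // ii0.
  by rewrite -ii0 si in i0s.
have [[G1 G1s G1x]|noG] :=
  pselect (exists2 G : S, (forall i, i \in s -> act G (x i) = 0)
                        & act G (x i0) != 0); last first.
  (* Here whatever kills the x i, i \in s, also kills x i0, hence y: x i0 can take coefficient 0. *)
  apply: (span 0 centralizer0) => G Gs; rewrite mulr0; apply: killy => i.
  rewrite inE => /predU1P[->|/Gs //].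
  by apply/eqP/negPn/negP => Gx; apply: noG; exists G.
pose G0 : S := (act G1 (x i0))^-1 *: G1.
have G0s i : i \in s -> act G0 (x i) = 0.
  by move=> /G1s Gi; rewrite actZl Gi mulr0.
have G0x : act G0 (x i0) = 1 by rewrite actZl mulVr // hF.
have Gy (G : S) : (forall i, i \in s -> act G (x i) = 0) ->
    act G y = act G (x i0) * act G0 y.
  move=> Gs; apply/eqP; rewrite -subr_eq0 -mulNr -actZl -actDl; apply/eqP.
  apply: killy => i; rewrite inE actDl actZl => /predU1P[->|si].
    by rewrite G0x mulr1 addrN.
  by rewrite Gs // G0s // mulr0 addr0.
apply: (span (act G0 y)) => //; apply/centralizerE => i.
rewrite -act_mulX Gy => [|j sj]; last by rewrite act_mulX G0s // evX0.
by rewrite act_mulX G0x evX1.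
Qed.

Lemma right_independentP (I : finType) (x : I -> F) :
  right_independent K x <->
  forall k, ~ forall G : S,
    (forall i, i != k -> act G (x i) = 0) -> act G (x k) = 0.
Proof.
split=> [indep k killk|sep c Kc sum0 k].
  have [||c Kc xk] := @annihilator_span _ (enum (predC1 k)) x (x k).
  - exact: enum_uniq.
  - by move=> G Gs; apply: killk => i ik; apply: Gs; rewrite mem_enum.
  (* Moving x k to the other side of its expression [xk] gives a relation with coefficient -1 at
     k. *)
  have : (if k == k then -1 else c k) = 0.
    apply: (indep (fun i => if i == k then -1 else c i)).
      by move=> i; case: eqP => // _; exact/centralizerN/centralizer1.
    rewrite (bigD1 k) //= eqxx mulrN1 [X in - X + _]xk big_enum addrC.
    apply/eqP; rewrite subr_eq0; apply/eqP/eq_bigr => i.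
    by move=> /negbTE ->.
  by move/eqP; rewrite eqxx oppr_eq0 oner_eq0.
(* If c k is invertible, a G killing the other x i reduces the relation to act G (x k) * c k = 0. *)
apply: contrapT => /eqP /hF Uck; apply: (sep k) => G Gx.
apply: (mulIr Uck); rewrite mul0r -act_centralizer //.
have := act0r a G; rewrite -{1}sum0 act_sumr (bigD1 k) //= big1 ?addr0 //.
by move=> i ik; rewrite act_centralizer // Gx ?mul0r.
Qed.

(** As x i is a unit, G kills x i exactly when it vanishes at the conjugate by x i. The range
    forgets repetitions; injectivity makes removing one point the same as removing one index. *)
Lemma Pindependent_conjugatesP (I : eqType) (x : I -> F) :
  (forall i, x i != 0) ->
  (injective (fun i => conjugate delta a (x i)) /\
   Pindependent delta (range (fun i => conjugate delta a (x i)))) <->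
  forall k, ~ forall G : S,
    (forall i, i != k -> act G (x i) = 0) -> act G (x k) = 0.
Proof.
move=> x0; set b := fun i => conjugate delta a (x i).
have Ux i : x i \is a GRing.unit by exact: hF.
have act_eq0 (G : S) i : act G (x i) = 0 <-> skew_eval G (b i) = 0.
  rewrite act_conjugate //; split=> [|->]; last by rewrite mul0r.
  by rewrite -[RHS](mul0r (x i)) => /(mulIr (Ux i)).
split=> [[b_inj indep] k killk|sep].
  apply: (indep (b k)); first by exists k.
  move=> G Gb; apply/act_eq0/killk => i ik; apply/act_eq0/Gb.
  by split; [exists i | move=> /b_inj /eqP; apply/negP].
split=> [i j bij|_ [k _ <-] closk].
  (* If b i = b j with i != j, any G killing x i also kills x j, so x j is not separated from the
     others. *)
  apply: contrapT => /eqP ij; apply: (sep j) => G Gx.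
  by apply/act_eq0; rewrite -bij; apply/act_eq0/Gx.
apply: (sep k) => G Gx; apply/act_eq0/closk => _ [[i _ <-] bik].
by apply/act_eq0/Gx/eqP => ik; apply: bik; rewrite ik.
Qed.

End Centralizer.

Theorem lemma15 (F : unitRingType) (hF : division_ring F)
    (n : nat) (hn : (0 < n)%N)
    (sigma : {rmorphism F -> 'M[F]_n}) (delta : sderivation sigma)
    (M : nat) (a : 'cV[F]_n) (b : 'I_M -> 'cV[F]_n) (beta : 'I_M -> F)
    (hbeta : forall i, beta i != 0)
    (hb : forall i, b i = conjugate delta a (beta i)) :
  (injective b /\ Pindependent delta (range b)) <->
  right_independent (centralizer delta a) beta.
Proof.
have -> : b = fun i => conjugate delta a (beta i) by exact: funext.
apply: iff_trans (iff_sym (right_independentP delta a hF beta)).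
exact: Pindependent_conjugatesP.
Qed.
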